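(* For a strategy profile $\boldsymbol{g}$ let $\mathcal{J}_T(\boldsymbol{g})=\mathbb{E}^{\boldsymbol{g}}[c_T(X_T,U_T^1,U_T^2)]$. Let $$J_T^1(\pi_T^1,u_T^2)=\inf_{u_T^1\in\mathcal{U}_T^1}\tilde c_T^1(\pi_T^1,u_T^1,u_T^2),\qquad J_T^2(\pi_T^2)=\inf_{u_T^2\in\mathcal{U}_T^2}\mathbb{E}\big[J_T^1(\Pi_T^1,u_T^2)\mid\pi_T^2,u_T^2\big],$$ with $g_T^{*1}(\pi_T^1,u_T^2)$ and $g_T^{*2}(\pi_T^2)$ denoting minimizers on the respective right-hand sides. 1) For all $\boldsymbol{g}\in\mathcal{G}''$, $\mathcal{J}_T(\boldsymbol{g})\ge\mathbb{E}^{\boldsymbol{g}}[J_T^2(\Pi_T^2)]$. 2) For all $\boldsymbol{g}\in\mathcal{G}''$, $\mathcal{J}_T(\boldsymbol{g}_{0:T-1},g_T^{*1},g_T^{*2})=\mathbb{E}^{\boldsymbol{g}}[J_T^2(\Pi_T^2)]$, where $\boldsymbol{g}_{0:T-1}$ are the laws of $\boldsymbol{g}$ at times $0,\dots,T-1$.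
   Context: Team model. Fix $T\in\mathbb{N}$; time runs over $t=0,\dots,T$. The state $X_t$ takes values in a finite set $\mathcal{X}_t$. Agents $k\in\{1,2\}$ choose actions $U_t^k$ in finite sets $\mathcal{U}_t^k$ and receive observations $Y_t^k$ in finite sets $\mathcal{Y}_t^k$. The dynamics are $X_{t+1}=f_t(X_t,U_t^1,U_t^2,W_t)$ for $t=0,\dots,T-1$, and $Y_t^k=h_t^k(X_t,V_t^k)$ for $t=0,\dots,T$, where the disturbances $W_t$ and noises $V_t^k$ take values in finite sets. The primitive random variables $X_0$, $W_t$, $V_t^1$, $V_t^2$ ($t=0,\dots,T$) are mutually independent with known distributions. The cost functions are $c_t:\mathcal{X}_t\times\mathcal{U}_t^1\times\mathcal{U}_t^2\to\mathbb{R}_{\ge 0}$. Memories. $M_t^2=\{Y_{0:t}^2,U_{0:t-1}^2\}$, $M_t^1=\{Y_{0:t}^1,U_{0:t-1}^1,Y_{0:t}^2,U_{0:t-1}^2\}$, and $L_t^{[1,2]}=M_t^1\setminus M_t^2=\{Y_{0:t}^1,U_{0:t-1}^1\}$ with finite set of possible values $\mathcal{L}_t^{[1,2]}$. Information states. $\Pi_t^1=\mathbb{P}^{\boldsymbol g}(X_t\mid M_t^1)\in\mathcal{P}_t^1=\Delta(\mathcal{X}_t)$ and $\Pi_t^2=\mathbb{P}^{\boldsymbol g}(X_t,L_t^{[1,2]}\mid M_t^2)\in\mathcal{P}_t^2=\Delta(\mathcal{X}_t\times\mathcal{L}_t^{[1,2]})$ under the strategy profile in use (additionally conditioning $\Pi_t^2$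 on past prescriptions, which are functions of $M_t^2$, changes nothing). Strategies. $\mathcal{G}''$ is the set of strategy profiles $\boldsymbol{g}=(g_t^1,g_t^2)_{t=0}^T$ of the form $U_t^1=g_t^1(\Pi_t^1,\Pi_t^2)$, $U_t^2=g_t^2(\Pi_t^2)$. At time $T$, agent 1 may also use $U_T^2$, i.e. a law $\bar g_T^1(\Pi_T^1,\Pi_T^2,U_T^2)$; given $U_T^2=g_T^2(\Pi_T^2)$ this is the same as the law $(\pi^1,\pi^2)\mapsto\bar g_T^1(\pi^1,\pi^2,g_T^2(\pi^2))$, so such laws are also denoted $g_T^1$. In particular $g_T^{*1}$ is used as $U_T^1=g_T^{*1}(\Pi_T^1,U_T^2)$. Expected cost: $\tilde c_T^1(\pi^1,u^1,u^2)=\sum_{x\in\mathcal{X}_T}\pi^1(x)\,c_T(x,u^1,u^2)$. Conditional expectation in $J_T^2$: let $e_T(\pi^2,l)(x)=\pi^2(x,l)/\sum_{x'}\pi^2(x',l)$ (an arbitrary fixed element of $\mathcal{P}_T^1$ if the denominator is $0$), so that $\Pi_T^1=e_T(\Pi_T^2,L_T^{[1,2]})$; then $\mathbb{E}[J_T^1(\Pi_T^1,u_T^2)\mid\pi_T^2,u_T^2]=\sum_{x,l}\pi_T^2(x,l)\,J_T^1(e_T(\pi_T^2,l),u_T^2)$. *)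

(* Defs.v *)
(* MathComp / MathComp-Analysis. *)
From HB Require Import structures.
From mathcomp Require Import all_boot all_order all_algebra.
From mathcomp Require Import all_classical all_reals all_analysis.

Set Implicit Arguments.
Unset Strict Implicit.
Unset Printing Implicit Defensive.

Import Order.TTheory GRing.Theory Num.Theory.

Local Open Scope classical_set_scope.
Local Open Scope ring_scope.

(* Carried by a sig type over a boolean predicate on finite functions: two laws
   are equal as soon as they agree pointwise. *)
Definition is_law (R : realType) (A : finType) (p : {ffun A -> R}) : bool :=
  [forall a, 0 <= p a] && (\sum_a p a == 1).

Definition simplex (R : realType) (A : finType) :=
  {p : {ffun A -> R} | is_law p}.

Definition minimizes (R : realType) (A : Type) (F : A -> R) (a : A) :=
  forall b, F a <= F b.

Definition discrete_rv d (Omega : measurableType d) (A : finType)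
    (Z : Omega -> A) :=
  forall a, measurable (Z @^-1` [set a]).

Lemma discrete_rv_comp3 d (Omega : measurableType d) (A B C D : finType)
    (Y : Omega -> A) (Z : Omega -> B) (V : Omega -> C) (F : A -> B -> C -> D) :
  discrete_rv Y -> discrete_rv Z -> discrete_rv V ->
  discrete_rv (fun w => F (Y w) (Z w) (V w)).
Proof.
move=> mY mZ mV e.
have -> : (fun w => F (Y w) (Z w) (V w)) @^-1` [set e] =
    \bigcup_(q in [set q : A * B * C | F q.1.1 q.1.2 q.2 = e])
      (Y @^-1` [set q.1.1] `&` Z @^-1` [set q.1.2] `&` V @^-1` [set q.2]).
  apply/seteqP; split=> [w /= Fe|w [[[a b] c] /= Fe [[-> ->] ->]]//].
  by exists (Y w, Z w, V w).
apply: fin_bigcup_measurable => // q _.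
by apply: measurableI; [apply: measurableI|]; [exact: mY|exact: mZ|exact: mV].
Qed.

(* When M = m is a null event the quotients are all 0, since x / 0 = 0, and
   insubd falls back on p0; otherwise they form a law. *)
Definition cond_law (R : realType) d (Omega : measurableType d)
    (P : probability Omega R) (A B : finType) (p0 : simplex R A)
    (Z : Omega -> A) (M : Omega -> B) (m : B) : simplex R A :=
  insubd p0 [ffun a => fine (P (Z @^-1` [set a] `&` M @^-1` [set m]))
                       / fine (P (M @^-1` [set m]))].

Lemma cond_law_null (R : realType) d (Omega : measurableType d)
    (P : probability Omega R) (A B : finType) (p0 : simplex R A)
    (Z : Omega -> A) (M : Omega -> B) (m : B) :
  P (M @^-1` [set m]) = 0%E -> cond_law P p0 Z M m = p0.
Proof.
move=> PM0; apply: val_inj; rewrite val_insubd PM0 /= /is_law.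
case: andP => // -[_]; rewrite big1 => [|a _]; first by rewrite eq_sym oner_eq0.
by rewrite ffunE invr0 mulr0.
Qed.

Lemma cond_lawE (R : realType) d (Omega : measurableType d)
    (P : probability Omega R) (A B : finType) (p0 : simplex R A)
    (Z : Omega -> A) (M : Omega -> B) (m : B) :
  discrete_rv Z -> discrete_rv M -> P (M @^-1` [set m]) != 0%E ->
  forall a, val (cond_law P p0 Z M m) a =
    fine (P (Z @^-1` [set a] `&` M @^-1` [set m])) / fine (P (M @^-1` [set m])).
Proof.
move=> mZ mM PM a; have mI b : measurable (Z @^-1` [set b] `&` M @^-1` [set m]).
  by apply: measurableI; [exact: mZ|exact: mM].
rewrite val_insubd ifT ?ffunE//; apply/andP; split.
  by apply/forallP => b; rewrite ffunE divr_ge0// fine_ge0.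
have PMf : fine (P (M @^-1` [set m])) != 0.
  by rewrite fine_eq0// fin_num_measure//; exact: mM.
apply/eqP; under eq_bigr do rewrite ffunE.
rewrite -mulr_suml; apply: (canLR (mulfK PMf)); rewrite mul1r.
rewrite sum_fine => [|b _]; last by rewrite fin_num_measure//; exact: mI.
congr fine; rewrite -big_enum fsbig_seq ?enum_uniq//.
rewrite -measure_fin_bigcup//.
- congr (P _); apply/seteqP; split=> [w [b _ []]//|w Mw].
  by exists (Z w) => //=; rewrite mem_enum.
- by move=> b c _ _ [w [[<- _] [<- _]]].
Qed.

(* Memory at time t of the data (y_s, u_s): y_0..y_t and u_0..u_{t-1}. *)
Fixpoint memory (Y U : nat -> finType) (t : nat) : finType :=
  match t with
  | 0 => Y 0
  | s.+1 => (memory Y U s * U s * Y s.+1)%type : finType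
  end.

(* All families are indexed by nat, but only their members at times t <= T
   matter: a model on 0..T can be continued by singletons and constant maps. *)
Record team (R : realType) (T : nat) := Team {
  state : nat -> finType;
  act1 : nat -> finType;
  act2 : nat -> finType;
  obs1 : nat -> finType;
  obs2 : nat -> finType;
  dist : nat -> finType;
  noise1 : nat -> finType;
  noise2 : nat -> finType;
  dynamics : forall t, state t -> act1 t -> act2 t -> dist t -> state t.+1;
  observe1 : forall t, state t -> noise1 t -> obs1 t;
  observe2 : forall t, state t -> noise2 t -> obs2 t;
  cost : forall t, state t -> act1 t -> act2 t -> R;
  cost_ge0 : forall t, (t <= T)%N -> forall x u1 u2, 0 <= cost (t := t) x u1 u2
}.

Record primitives (R : realType) (T : nat) (S : team R T)
    d (Omega : measurableType d) (P : probability Omega R) := Primitives {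
  X0 : Omega -> state S 0;
  W : forall t, Omega -> dist S t;
  V1 : forall t, Omega -> noise1 S t;
  V2 : forall t, Omega -> noise2 S t;
  X0_rv : discrete_rv X0;
  W_rv : forall t, (t <= T)%N -> discrete_rv (W t);
  V1_rv : forall t, (t <= T)%N -> discrete_rv (V1 t);
  V2_rv : forall t, (t <= T)%N -> discrete_rv (V2 t);
  (* The product rule for a subfamily is the case where the other sets are
     full. *)
  primitives_independent :
    forall (A0 : set (state S 0)) (AW : forall t, set (dist S t))
           (A1 : forall t, set (noise1 S t)) (A2 : forall t, set (noise2 S t)),
      P (X0 @^-1` A0 `&`
         \bigcap_(t in [set t | (t <= T)%N])
           (W t @^-1` AW t `&` V1 t @^-1` A1 t `&` V2 t @^-1` A2 t))
      = (P (X0 @^-1` A0) *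
         \prod_(t < T.+1)
           (P (W t @^-1` AW t) * P (V1 t @^-1` A1 t) * P (V2 t @^-1` A2 t)))%E
}.

(* L_t^{[1,2]} and M_t^2. As M_t^1 is their disjoint union, conditioning on
   M_t^1 is conditioning on the pair. *)
Definition private1 (R : realType) (T : nat) (S : team R T) (t : nat) : finType :=
  memory (obs1 S) (act1 S) t.

Definition memory2 (R : realType) (T : nat) (S : team R T) (t : nat) : finType :=
  memory (obs2 S) (act2 S) t.

Definition belief1 (R : realType) (T : nat) (S : team R T) (t : nat) :=
  simplex R (state S t).

Definition belief2 (R : realType) (T : nat) (S : team R T) (t : nat) :=
  simplex R (state S t * private1 S t)%type.

(* A terminal law of agent 1 that also uses U_T^2 is covered: U_T^2 is the
   function law2 of Pi_T^2. *)
Record strategy (R : realType) (T : nat) (S : team R T) := Strategy {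
  law1 : forall t, belief1 S t -> belief2 S t -> act1 S t;
  law2 : forall t, belief2 S t -> act2 S t
}.

(* Values of the conditional laws on null events. *)
Record null_beliefs (R : realType) (T : nat) (S : team R T) := NullBeliefs {
  null1 : forall t, belief1 S t;
  null2 : forall t, belief2 S t
}.

(* (X_t, L_t^{[1,2]}, M_t^2) *)
Definition configuration (R : realType) (T : nat) (S : team R T) (t : nat) :
    finType :=
  (state S t * private1 S t * memory2 S t)%type.

Definition Pi1_of (R : realType) (T : nat) (S : team R T)
    d (Omega : measurableType d) (P : probability Omega R)
    (N : null_beliefs S) (t : nat) (Z : Omega -> configuration S t)
    (w : Omega) : belief1 S t :=
  cond_law P (null1 N t) (fun v => (Z v).1.1) (fun v => ((Z v).1.2, (Z v).2))
    ((Z w).1.2, (Z w).2).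

Definition Pi2_of (R : realType) (T : nat) (S : team R T)
    d (Omega : measurableType d) (P : probability Omega R)
    (N : null_beliefs S) (t : nat) (Z : Omega -> configuration S t)
    (w : Omega) : belief2 S t :=
  cond_law P (null2 N t) (fun v => (Z v).1) (fun v => (Z v).2) (Z w).2.

(* The actions at time t are computed from the conditional laws of the process
   constructed so far, so the beliefs are those induced by g itself. *)
Fixpoint process (R : realType) (T : nat) (S : team R T)
    d (Omega : measurableType d) (P : probability Omega R)
    (xi : primitives S P) (N : null_beliefs S) (g : strategy S) (t : nat) :
    Omega -> configuration S t :=
  match t with
  | 0 => fun w =>
      let x := X0 xi w in
      (x, observe1 x (V1 xi 0 w), observe2 x (V2 xi 0 w))
  | s.+1 => fun w =>
      let Z := process xi N g s in
      let: (x, l, m) := Z w in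
      let u1 := law1 g (Pi1_of P N Z w) (Pi2_of P N Z w) in
      let u2 := law2 g (Pi2_of P N Z w) in
      let x' := dynamics x u1 u2 (W xi s w) in
      (x', (l, u1, observe1 x' (V1 xi s.+1 w)),
           (m, u2, observe2 x' (V2 xi s.+1 w)))
  end.

(* The events in the definitions of the beliefs are measurable, so cond_lawE
   applies to them. *)
Lemma process_rv (R : realType) (T : nat) (S : team R T)
    d (Omega : measurableType d) (P : probability Omega R)
    (xi : primitives S P) (N : null_beliefs S) (g : strategy S) (t : nat) :
  (t <= T)%N -> discrete_rv (process xi N g t).
Proof.
elim: t => [_|t IH tT] /=.
  have m1 := V1_rv xi (leq0n T); have m2 := V2_rv xi (leq0n T).
  have := discrete_rv_comp3
    (fun x v1 v2 => (x, observe1 x v1, observe2 x v2)) (X0_rv xi) m1 m2.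
  exact.
have mZ := IH (ltnW tT).
pose b (c : configuration S t) := let: (x, l, m) := c in
  (cond_law P (null1 N t) (fun v => (process xi N g t v).1.1)
     (fun v => ((process xi N g t v).1.2, (process xi N g t v).2)) (l, m),
   cond_law P (null2 N t) (fun v => (process xi N g t v).1)
     (fun v => (process xi N g t v).2) m).
pose F (c : configuration S t)
  (n : dist S t * noise1 S t.+1 * noise2 S t.+1) := let: (x, l, m) := c in
  let: (w, v1, v2) := n in
  let u1 := law1 g (b c).1 (b c).2 in
  let u2 := law2 g (b c).2 in
  let x' := dynamics x u1 u2 w in
  (x', (l, u1, observe1 x' v1), (m, u2, observe2 x' v2)) : configuration S t.+1.
have mN := discrete_rv_comp3 (fun w v1 v2 => (w, v1, v2)) (W_rv xi (ltnW tT))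
  (V1_rv xi tT) (V2_rv xi tT).
have := discrete_rv_comp3 (fun c n _ => F c n) mZ mN mN.
congr discrete_rv; apply/funext => w; rewrite /F /b /Pi1_of /Pi2_of.
by case: (process xi N g t w) => [[x l] m].
Qed.

Definition X (R : realType) (T : nat) (S : team R T)
    d (Omega : measurableType d) (P : probability Omega R)
    (xi : primitives S P) (N : null_beliefs S) (g : strategy S) (t : nat)
    (w : Omega) : state S t :=
  (process xi N g t w).1.1.

Definition Pi1 (R : realType) (T : nat) (S : team R T)
    d (Omega : measurableType d) (P : probability Omega R)
    (xi : primitives S P) (N : null_beliefs S) (g : strategy S) (t : nat) :
    Omega -> belief1 S t :=
  Pi1_of P N (process xi N g t).

Definition Pi2 (R : realType) (T : nat) (S : team R T)
    d (Omega : measurableType d) (P : probability Omega R)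
    (xi : primitives S P) (N : null_beliefs S) (g : strategy S) (t : nat) :
    Omega -> belief2 S t :=
  Pi2_of P N (process xi N g t).

Definition U1 (R : realType) (T : nat) (S : team R T)
    d (Omega : measurableType d) (P : probability Omega R)
    (xi : primitives S P) (N : null_beliefs S) (g : strategy S) (t : nat)
    (w : Omega) : act1 S t :=
  law1 g (Pi1 xi N g t w) (Pi2 xi N g t w).

Definition U2 (R : realType) (T : nat) (S : team R T)
    d (Omega : measurableType d) (P : probability Omega R)
    (xi : primitives S P) (N : null_beliefs S) (g : strategy S) (t : nat)
    (w : Omega) : act2 S t :=
  law2 g (Pi2 xi N g t w).

Definition terminal_cost (R : realType) (T : nat) (S : team R T)
    d (Omega : measurableType d) (P : probability Omega R)
    (xi : primitives S P) (N : null_beliefs S) (g : strategy S) : \bar R :=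
  'E_P[fun w => cost (X xi N g T w) (U1 xi N g T w) (U2 xi N g T w)]%E.

Definition expected_cost (R : realType) (T : nat) (S : team R T)
    (p1 : belief1 S T) (u1 : act1 S T) (u2 : act2 S T) : R :=
  \sum_x val p1 x * cost x u1 u2.

Definition J1 (R : realType) (T : nat) (S : team R T)
    (p1 : belief1 S T) (u2 : act2 S T) : R :=
  inf (range (fun u1 => expected_cost p1 u1 u2)).

(* The posterior e_T(p2, l) of the state; its value is e0 when l has
   probability 0, by the same convention as in cond_law. *)
Definition posterior (R : realType) (T : nat) (S : team R T)
    (e0 : belief1 S T) (p2 : belief2 S T) (l : private1 S T) : belief1 S T :=
  insubd e0 [ffun x => val p2 (x, l) / \sum_x' val p2 (x', l)].

Definition expected_J1 (R : realType) (T : nat) (S : team R T)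
    (e0 : belief1 S T) (p2 : belief2 S T) (u2 : act2 S T) : R :=
  \sum_x \sum_l val p2 (x, l) * J1 (posterior e0 p2 l) u2.

Definition J2 (R : realType) (T : nat) (S : team R T)
    (e0 : belief1 S T) (p2 : belief2 S T) : R :=
  inf (range (fun u2 => expected_J1 e0 p2 u2)).

(* (g_{0:T-1}, h1, h2): dfwith changes only the member at time T, where agent
   1 uses U_T^1 = h1(Pi_T^1, U_T^2). *)
Definition with_terminal_laws (R : realType) (T : nat) (S : team R T)
    (g : strategy S) (h1 : belief1 S T -> act2 S T -> act1 S T)
    (h2 : belief2 S T -> act2 S T) : strategy S :=
  Strategy
    (dfwith (@law1 _ _ _ g) T (fun p1 p2 => h1 p1 (h2 p2)))
    (dfwith (@law2 _ _ _ g) T h2).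

(* Main.v *)
Require Import Defs.
From mathcomp Require Import all_boot all_order all_algebra.
From mathcomp Require Import all_classical all_reals all_analysis.

(** The information of agent 2 at the terminal time is contained in that of
    agent 1, so the expected terminal cost can be averaged in two stages, each
    an instance of the tower property [expectation_cond_law].  Conditioning on
    M_T^1 = (L_T, M_T^2), which determines both actions, replaces c_T by
    [expected_cost] at Pi_T^1 ([terminal_cost_expected_cost]); minimizing over
    the action of agent 1 bounds this from below by J_T^1(Pi_T^1, U_T^2).
    Almost surely Pi_T^1 is the posterior of Pi_T^2 given L_T
    ([cond_law_posterior], Bayes' rule), so conditioning on M_T^2 turns the
    expectation of J_T^1(Pi_T^1, U_T^2) into that of the function minimized in
    J_T^2 ([expectation_J1]); minimizing over the action of agent 2 bounds it
    from below by J_T^2(Pi_T^2).  Both bounds are attained by minimizers, and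
    replacing the laws at time T leaves the process up to time T, hence the
    terminal beliefs, unchanged ([process_eq_past]).

    All random variables are functions of finitely valued ones, so every
    expectation is a finite sum ([expectation_discrete]), and an identity
    between integrands is needed only at values of positive probability. *)

Set Implicit Arguments.
Unset Strict Implicit.
Unset Printing Implicit Defensive.

Import Order.TTheory GRing.Theory Num.Theory.

Local Open Scope classical_set_scope.
Local Open Scope ring_scope.

Lemma minimizes_inf (R : realType) (A : Type) (F : A -> R) (a : A) :
  minimizes F a -> inf (range F) = F a.
Proof.
move=> Fa; apply/eqP; rewrite eq_le; apply/andP; split.
  by apply: ge_inf; [exists (F a) => _ [b _ <-]; exact: Fa|exists a].
by apply: lb_le_inf; [exists (F a), a|move=> _ [b _ <-]; exact: Fa].
Qed.

Section DiscreteExpectation.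
Context (R : realType) d (Omega : measurableType d) (P : probability Omega R).

Lemma discrete_rv_comp (A B : finType) (Z : Omega -> A) (f : A -> B) :
  discrete_rv Z -> discrete_rv (f \o Z).
Proof. by move=> mZ; exact: (discrete_rv_comp3 (fun a _ _ => f a) mZ mZ mZ). Qed.

Lemma expectation_discrete (A : finType) (Z : Omega -> A) (F : A -> R) :
  discrete_rv Z ->
  ('E_P[fun w => F (Z w)] = (\sum_a fine (P (Z @^-1` [set a])) * F a)%:E)%E.
Proof.
move=> mZ; rewrite unlock.
have FZ w : (F (Z w))%:E = (\sum_a (F a)%:E * (\1_(Z @^-1` [set a]) w)%:E)%E.
  rewrite (bigD1 (Z w))//= indicE mem_set//= mule1 big1 ?adde0// => a neq.
  rewrite indicE memNset ?mule0// => /= Za.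
  by rewrite Za eqxx in neq.
under eq_integral do rewrite FZ.
have iI a : P.-integrable setT (fun w => (\1_(Z @^-1` [set a]) w)%:E).
  by apply: integrable_indic => //; exact: mZ.
rewrite integral_sum//; last by move=> a; apply: integrableZl.
rewrite -sumEFin; apply: eq_bigr => a _.
rewrite integralZl//.
rewrite integral_indic//.
by rewrite setIT EFinM fineK ?fin_num_measure// muleC.
Qed.

Lemma le_expectation_discrete (A : finType) (Z : Omega -> A) (F G : A -> R) :
  discrete_rv Z -> (forall a, F a <= G a) ->
  ('E_P[fun w => F (Z w)] <= 'E_P[fun w => G (Z w)])%E.
Proof.
move=> mZ FG; rewrite !expectation_discrete// lee_fin.
by apply: ler_sum => a _; apply: ler_wpM2l => //; exact: fine_ge0.
Qed.

Lemma eq_expectation_discrete (A : finType) (Z : Omega -> A) (F G : A -> R) :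
  discrete_rv Z -> (forall a, P (Z @^-1` [set a]) != 0%E -> F a = G a) ->
  ('E_P[fun w => F (Z w)] = 'E_P[fun w => G (Z w)])%E.
Proof.
move=> mZ FG; rewrite !expectation_discrete//; congr EFin.
apply: eq_bigr => a _; have [->|/FG->//] := eqVneq (P (Z @^-1` [set a])) 0%E.
by rewrite !mul0r.
Qed.

(** On a null event M = m the default law p0 is harmless: both sides are 0. *)
Lemma cond_law_chain (A B : finType) (p0 : simplex R A)
    (Z : Omega -> A) (M : Omega -> B) (a : A) (m : B) :
  discrete_rv Z -> discrete_rv M ->
  fine (P (Z @^-1` [set a] `&` M @^-1` [set m])) =
  fine (P (M @^-1` [set m])) * val (cond_law P p0 Z M m) a.
Proof.
move=> mZ mM; have [PM0|PM] := eqVneq (P (M @^-1` [set m])) 0%E; last first.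
  rewrite cond_lawE// mulrCA divff ?mulr1//.
  by rewrite fine_eq0// fin_num_measure//; exact: mM.
rewrite PM0 mul0r (_ : P _ = 0%E)//; apply: (subset_measure0 _ _ _ PM0).
- by apply: measurableI; [exact: mZ|exact: mM].
- exact: mM.
- exact: subIsetr.
Qed.

(** Tower property: given M, integrate out Z against its conditional law. *)
Lemma expectation_cond_law (A B : finType) (p0 : simplex R A)
    (Z : Omega -> A) (M : Omega -> B) (F : A -> B -> R) :
  discrete_rv Z -> discrete_rv M ->
  ('E_P[fun w => F (Z w) (M w)] =
   'E_P[fun w => (\sum_a val (cond_law P p0 Z M (M w)) a * F a (M w))%R])%E.
Proof.
move=> mZ mM.
have mZM : discrete_rv (fun w => (Z w, M w)).
  exact: (discrete_rv_comp3 (fun a b _ => (a, b)) mZ mM mM).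
rewrite (expectation_discrete (fun c => F c.1 c.2) mZM).
rewrite (expectation_discrete
  (fun b => \sum_a val (cond_law P p0 Z M b) a * F a b) mM).
congr EFin; under [RHS]eq_bigr do rewrite mulr_sumr.
rewrite exchange_big pair_big/=; apply: eq_bigr => -[a b] _ /=.
rewrite mulrA -cond_law_chain//; congr (fine (P _) * _).
by apply/seteqP; split=> w /= [-> ->].
Qed.

End DiscreteExpectation.

Lemma simplex_sum (R : realType) (A : finType) (p : simplex R A) :
  \sum_a val p a = 1.
Proof. by case: p => p /= /andP[_ /eqP]. Qed.

Section TerminalTime.
Context (R : realType) (T : nat) (S : team R T) d (Omega : measurableType d)
  (P : probability Omega R).

(** Bayes' rule: where (L, M) = (l, m) has positive probability, conditioning
    on (L, M) amounts to conditioning on M and then on L. *)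
Lemma cond_law_posterior (Z : Omega -> configuration S T)
    (n1 e0 : belief1 S T) (n2 : belief2 S T)
    (l : private1 S T) (m : memory2 S T) :
  discrete_rv Z ->
  P ((fun v => ((Z v).1.2, (Z v).2)) @^-1` [set (l, m)]) != 0%E ->
  cond_law P n1 (fun v => (Z v).1.1) (fun v => ((Z v).1.2, (Z v).2)) (l, m) =
  posterior e0 (cond_law P n2 (fun v => (Z v).1) (fun v => (Z v).2) m) l.
Proof.
move=> mZ PLM.
have mX := discrete_rv_comp (fun c : configuration S T => c.1.1) mZ.
have mXL := discrete_rv_comp (fun c : configuration S T => c.1) mZ.
have mM := discrete_rv_comp (fun c : configuration S T => c.2) mZ.
have mLM := discrete_rv_comp (fun c : configuration S T => (c.1.2, c.2)) mZ.
set b1 := LHS; set b2 := cond_law P n2 _ _ m.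
set pLM := fine (P ((fun v => ((Z v).1.2, (Z v).2)) @^-1` [set (l, m)])).
set pM := fine (P ((fun v => (Z v).2) @^-1` [set m])).
have pLM0 : pLM != 0 by rewrite fine_eq0// fin_num_measure//; exact: mLM.
(* Both sides are the probability of (X, L, M) = (x, l, m). *)
have joint x : pLM * val b1 x = pM * val b2 (x, l).
  rewrite -!cond_law_chain//; congr (fine (P _)).
  apply/seteqP; split=> v /=; case: (Z v) => -[x' l'] m' /=.
    by move=> [-> [-> ->]].
  by move=> [[-> ->] ->].
(* Summing over x, where b1 has total mass 1, gives the probability of
   (L, M) = (l, m). *)
have marg : pLM = pM * \sum_x val b2 (x, l).
  by rewrite mulr_sumr -(eq_bigr _ (fun x _ => joint x)) -mulr_sumr simplex_sum
    mulr1.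
have : pM * \sum_x val b2 (x, l) != 0 by rewrite -marg.
rewrite mulf_eq0 negb_or => /andP[pM0 s0].
rewrite /posterior (_ : [ffun x => _] = val b1) ?valKd//.
apply/ffunP => x; rewrite ffunE.
by apply: (mulfI pLM0); rewrite joint marg mulrACA divff// mulr1.
Qed.

Context (xi : primitives S P) (N : null_beliefs S).

(** The beliefs that determine the actions at time s are computed from the
    process at time s alone, so laws from time t on cannot influence the process
    at time t. *)
Lemma process_eq_past (g h : strategy S) t :
  (forall s, (s < t)%N -> law1 g (t := s) = law1 h (t := s)) ->
  (forall s, (s < t)%N -> law2 g (t := s) = law2 h (t := s)) ->
  process xi N g t = process xi N h t.
Proof.
elim: t => [//|t IH] gh1 gh2 /=; rewrite IH.
- by rewrite gh1// gh2.
- by move=> s st; apply: gh1; exact: ltnW.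
- by move=> s st; apply: gh2; exact: ltnW.
Qed.

Context (g : strategy S).

Let mZ : discrete_rv (process xi N g T) := process_rv xi N g (leqnn T).

(** Given M_T^1 both actions are constant, so averaging over the state against
    Pi_T^1 leaves only the cost to be integrated. *)
Lemma terminal_cost_expected_cost :
  terminal_cost xi N g =
  ('E_P[fun w => expected_cost (Pi1 xi N g T w) (U1 xi N g T w)
                               (U2 xi N g T w)])%E.
Proof.
have mX := discrete_rv_comp (fun c : configuration S T => c.1.1) mZ.
have mLM := discrete_rv_comp (fun c : configuration S T => (c.1.2, c.2)) mZ.
pose b1 lm := cond_law P (null1 N T) (fun v => (process xi N g T v).1.1)
  (fun v => ((process xi N g T v).1.2, (process xi N g T v).2)) lm.
pose b2 m := cond_law P (null2 N T) (fun v => (process xi N g T v).1)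
  (fun v => (process xi N g T v).2) m.
exact: (expectation_cond_law P (null1 N T) (fun x lm =>
  cost x (law1 g (b1 lm) (b2 lm.2)) (law2 g (b2 lm.2))) mX mLM).
Qed.

(** Pi_T^1 may differ from the posterior of Pi_T^2 on null events, where the
    default beliefs are unrelated; this is why the one replaces the other inside
    the expectation and not pointwise. *)
Lemma expectation_J1 (e0 : belief1 S T) :
  ('E_P[fun w => J1 (Pi1 xi N g T w) (U2 xi N g T w)] =
   'E_P[fun w => expected_J1 e0 (Pi2 xi N g T w) (U2 xi N g T w)])%E.
Proof.
have mXL := discrete_rv_comp (fun c : configuration S T => c.1) mZ.
have mM := discrete_rv_comp (fun c : configuration S T => c.2) mZ.
have mLM := discrete_rv_comp (fun c : configuration S T => (c.1.2, c.2)) mZ.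
pose b1 lm := cond_law P (null1 N T) (fun v => (process xi N g T v).1.1)
  (fun v => ((process xi N g T v).1.2, (process xi N g T v).2)) lm.
pose b2 m := cond_law P (null2 N T) (fun v => (process xi N g T v).1)
  (fun v => (process xi N g T v).2) m.
have Bayes := eq_expectation_discrete (P := P)
  (F := fun lm => J1 (b1 lm) (law2 g (b2 lm.2)))
  (G := fun lm => J1 (posterior e0 (b2 lm.2) lm.1) (law2 g (b2 lm.2))) mLM.
rewrite [LHS]Bayes => [|[l m] Plm]; last first.
  by rewrite /b1 (cond_law_posterior _ e0 (null2 N T)).
have tower := expectation_cond_law P (null2 N T)
  (fun (xl : state S T * private1 S T) m =>
    J1 (posterior e0 (b2 m) xl.2) (law2 g (b2 m))) mXL mM.
rewrite [LHS]tower; congr expectation; apply/funext => w.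
by rewrite /expected_J1 pair_big; apply: eq_bigr => -[x l].
Qed.

End TerminalTime.

Theorem lemma11 (R : realType) (T : nat) (S : team R T)
    (d : measure_display) (Omega : measurableType d) (P : probability Omega R)
    (xi : primitives S P) (N : null_beliefs S) (e0 : belief1 S T)
    (g1star : belief1 S T -> act2 S T -> act1 S T)
    (g2star : belief2 S T -> act2 S T)
    (g1star_min : forall p1 u2,
      minimizes (fun u1 => expected_cost p1 u1 u2) (g1star p1 u2))
    (g2star_min : forall p2,
      minimizes (fun u2 => expected_J1 e0 p2 u2) (g2star p2)) :
  (forall g : strategy S,
     ('E_P[fun w => J2 e0 (Pi2 xi N g T w)] <= terminal_cost xi N g)%E) /\
  (forall g : strategy S,
     terminal_cost xi N (with_terminal_laws g g1star g2star)
     = 'E_P[fun w => J2 e0 (Pi2 xi N g T w)]%E).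
Proof.
have J1E p1 u2 : J1 p1 u2 = expected_cost p1 (g1star p1 u2) u2.
  exact: minimizes_inf (g1star_min p1 u2).
have J2E p2 : J2 e0 p2 = expected_J1 e0 p2 (g2star p2).
  exact: minimizes_inf (g2star_min p2).
split=> g.
  have mZ := process_rv xi N g (leqnn T).
  (* The beliefs as functions of the configuration, to compare integrands value
     by value. *)
  pose b1 (c : configuration S T) := cond_law P (null1 N T)
    (fun v => (process xi N g T v).1.1)
    (fun v => ((process xi N g T v).1.2, (process xi N g T v).2)) (c.1.2, c.2).
  pose b2 (c : configuration S T) := cond_law P (null2 N T)
    (fun v => (process xi N g T v).1) (fun v => (process xi N g T v).2) c.2.
  apply: (@le_trans _ _
    'E_P[fun w => expected_J1 e0 (Pi2 xi N g T w) (U2 xi N g T w)]%E).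
    apply: (le_expectation_discrete P (F := fun c => J2 e0 (b2 c))
      (G := fun c => expected_J1 e0 (b2 c) (law2 g (b2 c))) mZ) => c.
    by rewrite J2E; exact: g2star_min.
  rewrite -expectation_J1 terminal_cost_expected_cost.
  apply: (le_expectation_discrete P (F := fun c => J1 (b1 c) (law2 g (b2 c)))
    (G := fun c => expected_cost (b1 c) (law1 g (b1 c) (b2 c))
                                 (law2 g (b2 c))) mZ) => c.
  by rewrite J1E; exact: g1star_min.
set h := with_terminal_laws g g1star g2star.
have Zh : process xi N h T = process xi N g T.
  by apply: process_eq_past => s sT /=; rewrite dfwithout// gtn_eqF.
have U2h w : U2 xi N h T w = g2star (Pi2 xi N h T w) by rewrite /U2 /= dfwithin.
have U1h w : U1 xi N h T w = g1star (Pi1 xi N h T w) (U2 xi N h T w).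
  by rewrite U2h /U1 /= dfwithin.
rewrite terminal_cost_expected_cost; under eq_fun do rewrite U1h -J1E.
rewrite (expectation_J1 _ _ _ e0); under eq_fun do rewrite U2h -J2E.
by rewrite /Pi2 Zh.
Qed.
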